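(* Let $q\in(0,\infty)$ and let $\xi$ be an approximate design whose information matrix $\mathbf{M}(\xi)$ is non-singular. Then Kiefer's $\Phi_q$-criterion for the prediction of individual parameters, $\Phi_q(\xi)=\left(\frac{1}{np}\,\mathrm{tr}\left(\mathrm{MSE}(\xi)^{q}\right)\right)^{1/q}$, is given by $$\Phi_q(\xi)=\left(\frac{1}{np}\left(\mathrm{tr}\left(\mathbf{M}(\xi)^{-q}\right)+(n-1)\,\mathrm{tr}\left(\left(\mathbf{M}(\xi)+\mathbf{\Delta}^{-1}\right)^{-q}\right)\right)\right)^{\frac{1}{q}}.$$
   Context: Random coefficients regression model: $Y_{ij}=\mathbf{f}(x_j)^\top\boldsymbol{\beta}_i+\varepsilon_{ij}$, $j=1,\dots,m$, $i=1,\dots,n$, with $m,n\ge 1$, experimental region $\mathcal{X}$, known regression functions $\mathbf{f}=(f_1,\dots,f_p)^\top:\mathcal{X}\to\mathbb{R}^p$, uncorrelated zero-mean errors of variance $\sigma^2>0$, and individual parameters $\boldsymbol{\beta}_i$ with unknown mean and $\mathrm{Cov}(\boldsymbol{\beta}_i)=\sigma^2\mathbf{D}$, where $\mathbf{D}$ is a known (symmetric) positive definite $p\times p$ matrix. Put $\mathbf{\Delta}=m\,\mathbf{D}$. An approximate design $\xi$ consists of finitely many distinct points $x_1,\dots,x_k\in\mathcal{X}$ with weights $w_j\ge 0$, $\sum_{j=1}^k w_j=1$. Its (fixed effects, standardized) information matrix is $\mathbf{M}(\xi)=\sum_{j=1}^k w_j\,\mathbf{f}(x_j)\mathbf{f}(x_j)^\top$,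 assumed non-singular. The (standardized) mean squared error matrix for the best linear unbiased prediction of $(\boldsymbol{\beta}_1^\top,\dots,\boldsymbol{\beta}_n^\top)^\top$ is the $np\times np$ matrix $$\mathrm{MSE}(\xi)=\tfrac1n\left(\mathbf{1}_n\mathbf{1}_n^\top\right)\otimes\mathbf{M}(\xi)^{-1}+\left(\mathbf{I}_n-\tfrac1n\mathbf{1}_n\mathbf{1}_n^\top\right)\otimes\left(\mathbf{M}(\xi)+\mathbf{\Delta}^{-1}\right)^{-1},$$ where $\mathbf{1}_n$ is the all-ones vector of length $n$, $\mathbf{I}_n$ the identity matrix, and $\otimes$ the Kronecker product. Real powers of symmetric positive definite matrices are taken in the sense of the spectral calculus. *)

(* Defs.v *)
From mathcomp Require Import all_boot all_order all_algebra.
From mathcomp Require Import all_classical all_reals all_analysis.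
From mathcomp.real_closed Require Import mxtens.

Set Implicit Arguments.
Unset Strict Implicit.
Unset Printing Implicit Defensive.

Import Order.TTheory GRing.Theory Num.Theory.

Local Open Scope classical_set_scope.
Local Open Scope ring_scope.

Definition posdefmx (R : realType) (p : nat) (A : 'M[R]_p) : Prop :=
  A^T = A /\ forall v : 'cV[R]_p, v != 0 -> 0 < (v^T *m A *m v) 0 0.

(* Spectral calculus for real symmetric matrices: if A = P^T diag(d) P with P
   orthogonal, then g(A) = P^T diag(g(d)) P.  By [mxspectralE] the value does
   not depend on the chosen decomposition; the default 0 is only taken when A
   has no such decomposition, i.e. when A is not symmetric. *)
Definition mxspectral (R : realType) (p : nat) (g : R -> R) (A : 'M[R]_p) :
    'M[R]_p :=
  xget 0 [set B : 'M[R]_p | exists (P : 'M[R]_p) (d : 'rV[R]_p),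
    [/\ P *m P^T = 1%:M,
        A = P^T *m diag_mx d *m P
      & B = P^T *m diag_mx (map_mx g d) *m P]].

Lemma mxspectralE (R : realType) (p : nat) (g : R -> R) (P : 'M[R]_p)
    (d : 'rV[R]_p) :
  P *m P^T = 1%:M ->
  mxspectral g (P^T *m diag_mx d *m P) = P^T *m diag_mx (map_mx g d) *m P.
Proof.
move=> PP; apply: xget_unique; first by exists P, d.
move=> _ [Q [e [QQ PQ ->]]].
have PTP := mulmx1C PP; have QTQ := mulmx1C QQ.
pose W := P *m Q^T.
have dW : diag_mx d *m W = W *m diag_mx e.
  have := congr1 (fun X => P *m X *m Q^T) PQ.
  rewrite /W !mulmxA PP mul1mx => ->.
  by rewrite -!mulmxA QQ mulmx1.
have gW : diag_mx (map_mx g d) *m W = W *m diag_mx (map_mx g e).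
  apply/matrixP => i j; move/matrixP/(_ i j): dW.
  rewrite !mul_diag_mx !mul_mx_diag !mxE => deq.
  have [->|W0] := eqVneq (\sum_k P i k * Q^T k j) 0; first by rewrite mulr0 mul0r.
  rewrite mulrC; congr (_ * g _); apply: (mulIf W0).
  by rewrite deq mulrC.
have := congr1 (fun X => P^T *m X *m Q) gW.
rewrite /W !mulmxA PTP mul1mx => <-.
by rewrite -!mulmxA QTQ mulmx1.
Qed.

(* The real power A^r; meaningful for positive definite A, where only
   positive eigenvalues are raised to the power r. *)
Definition mxpowR (R : realType) (p : nat) (A : 'M[R]_p) (r : R) : 'M[R]_p :=
  mxspectral (fun a => a `^ r) A.

Record design (R : realType) (X : Type) := Design {
  design_size : nat;
  design_point : 'I_design_size -> X;
  design_weight : 'I_design_size -> R;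
  design_point_inj : injective design_point;
  design_weight_ge0 : forall j, 0 <= design_weight j;
  design_weight_sum1 : \sum_j design_weight j = 1
}.

Arguments design_point {R X} d _.
Arguments design_weight {R X} d _.

Section Prediction.
Variables (R : realType) (X : Type) (p : nat) (f : X -> 'cV[R]_p).

Definition information_mx (xi : design R X) : 'M[R]_p :=
  \sum_j design_weight xi j *:
    (f (design_point xi j) *m (f (design_point xi j))^T).

Definition Delta_mx (m : nat) (D : 'M[R]_p) : 'M[R]_p := m%:R *: D.

(* Standardized mean squared error matrix of the best linear unbiased
   prediction of the n stacked individual parameters; [tensmx] is the Kronecker
   product, with the individuals indexing the outer blocks. *)
Definition MSE_mx (m n : nat) (D : 'M[R]_p) (xi : design R X) :
    'M[R]_(n * p) :=
  let M := information_mx xi in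
  let one_n : 'cV[R]_n := const_mx 1 in
  let J : 'M[R]_n := n%:R^-1 *: (one_n *m one_n^T) in
  tensmx J (invmx M)
  + tensmx (1%:M - J) (invmx (M + invmx (Delta_mx m D))).

Definition Kiefer_Phi (m n : nat) (D : 'M[R]_p) (q : R) (xi : design R X) : R :=
  ((n * p)%:R^-1 * \tr (mxpowR (MSE_mx m n D xi) q)) `^ q^-1.

End Prediction.

(* Main.v *)
(** J = 1 1^T / n is an orthogonal projection of rank one, and the MSE matrix is
    J (x) M^-1 + (1 - J) (x) (M + Delta^-1)^-1.  Orthogonal diagonalizations of
    J, M and M + Delta^-1 combine into one of the MSE matrix.  As J has only the
    eigenvalues 0 and 1, every eigenvalue of the MSE matrix is one of M^-1 (with
    total multiplicity factor tr J = 1) or one of (M + Delta^-1)^-1 (with factor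
    tr (1 - J) = n - 1).  The existence of a diagonalization, for real symmetric
    matrices, is by induction on the size, splitting off a real eigenvector
    with a Householder reflection. *)
Require Import Defs.
From mathcomp Require Import all_boot all_order all_algebra.
From mathcomp Require Import all_classical all_reals all_analysis.
From mathcomp Require Import spectral sesquilinear ring.
From mathcomp.real_closed Require Import complex mxtens.

Import Order.TTheory GRing.Theory Num.Theory.

Local Open Scope ring_scope.

(** * Orthogonal diagonalization of real symmetric matrices *)

Section RealSpectralTheorem.
Variable R : rcfType.

Lemma mulmx_tr_row_gt0 n (v : 'rV[R]_n) : v != 0 -> 0 < (v *m v^T) 0 0.
Proof.
move=> v0; have [j vj] : exists j, v 0 j != 0.
  by apply/existsP; apply: contraNT v0 => /existsPn v0; apply/eqP/rowP => j;
     rewrite mxE; apply/eqP; have := v0 j; rewrite negbK.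
rewrite mxE (bigD1 j) //= mxE -expr2 ltr_wpDr ?sumr_ge0 //.
  by move=> i _; rewrite mxE -expr2 sqr_ge0.
by rewrite lt_def sqr_ge0 expf_neq0.
Qed.

(** The reflection in the hyperplane orthogonal to [v - w] swaps two vectors of equal length. *)
Lemma householder n (v w : 'rV[R]_n) : v *m v^T = w *m w^T ->
  exists H : 'M[R]_n, [/\ H^T = H, H *m H = 1%:M & w *m H = v].
Proof.
move=> vw; have [<-|neq] := eqVneq v w.
  by exists 1%:M; rewrite trmx1 !mulmx1.
pose u := v - w; pose s := (u *m u^T) 0 0.
have s0 : s != 0 by rewrite gt_eqF // mulmx_tr_row_gt0 // subr_eq0.
have uu : u *m u^T = s%:M by rewrite [LHS]mx11_scalar.
have uuu : (u^T *m u) *m (u^T *m u) = s *: (u^T *m u).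
  by rewrite mulmxA -(mulmxA u^T) uu mul_mx_scalar -scalemxAl.
(* Equal lengths give |v - w|^2 = 2|w|^2 - 2 w.v = -2 w.(v - w). *)
have wu : w *m u^T = (- (s / 2))%:M.
  rewrite [LHS]mx11_scalar; congr _%:M.
  have wv : w *m v^T = v *m w^T.
    apply: trmx_inj; rewrite trmx_mul trmxK [LHS]mx11_scalar [RHS]mx11_scalar.
    by rewrite !mxE.
  have : u *m u^T = - (2 *: (w *m u^T)).
    rewrite /u linearB /= !mulmxBl !mulmxBr vw wv scalerBr !scaler_nat !mulr2n.
    by apply/matrixP => i j; rewrite !mxE; ring.
  move/(congr1 (fun A : 'M[R]_1 => A 0 0)); rewrite -/s !mxE => ->.
  by field.
exists (1%:M - (2 / s) *: (u^T *m u)); split.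
- by rewrite linearB linearZ /= trmx_mul trmxK trmx1.
- move: (u^T *m u) uuu => K KK.
  rewrite mulmxBl !mulmxBr !mul1mx !mulmx1 -scalemxAl -scalemxAr KK !scalerA.
  have -> : 2 / s * (2 / s) * s = 2 / s + 2 / s by field.
  by rewrite scalerDl opprB addrK subrK.
- rewrite mulmxBr mulmx1 -scalemxAr mulmxA wu mul_scalar_mx scalerA.
  have -> : 2 / s * - (s / 2) = -1 by field.
  by rewrite scaleN1r opprK /u addrC subrK.
Qed.

(* The eigenvalues of A over R[i] are real since A is Hermitian there. *)
Lemma symmetric_eigenvalue n (A : 'M[R]_n.+1) : A^T = A ->
  exists a, eigenvalue A a.
Proof.
move=> AT; pose AC := map_mx (real_complex R) A.
have ACh : AC \is hermsymmx.
  apply: realsym_hermsym.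
    by apply/is_hermitianmxP; rewrite expr0 scale1r map_mx_id // map_trmx AT.
  by apply/mxOverP => i j; rewrite mxE; apply/complex_realP; exists (A i j).
have /mxOverP/(_ 0 0) := hermitian_spectral_diag_real ACh.
have /hermitian_normalmx/orthomx_spectralP := ACh.
set P := spectralmx AC; set d := spectral_diag AC => ACE.
have Pu : P \in unitmx by exact: spectral_unit.
have evC : eigenvalue AC (d 0 0).
  apply/eigenvalueP; exists (row 0 P).
    rewrite -row_mul {1}ACE !mulmxA mulmxV // mul1mx row_mul row_diag_mx.
    by rewrite -scalemxAl -rowE.
  apply/eqP => /(congr1 (mulmx^~ (invmx P))).
  rewrite rowE mulmxK // mul0mx => /rowP/(_ 0)/eqP.
  by rewrite !mxE !eqxx oner_eq0.
(* Being a root of the characteristic polynomial descends along the embedding of [R] into [R[i]]. *)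
move=> /complex_realP [a da]; exists a.
move: evC; rewrite da !eigenvalue_root_char -map_char_poly.
by rewrite fmorph_root.
Qed.

Lemma symmetric_spectral n (A : 'M[R]_n) : A^T = A ->
  exists (P : 'M[R]_n) (d : 'rV[R]_n),
    P *m P^T = 1%:M /\ A = P^T *m diag_mx d *m P.
Proof.
elim: n A => [|n IHn] A AT.
  by exists 1%:M, 0; split; apply/matrixP => - [].
have [a /eigenvalueP [v vA v0]] := symmetric_eigenvalue n A AT.
pose r := Num.sqrt ((v *m v^T) 0 0); pose w := r^-1 *: v.
have r2 : r ^+ 2 = (v *m v^T) 0 0.
  by rewrite sqr_sqrtr // ltW // mulmx_tr_row_gt0.
have r0 : r != 0.
  by rewrite -sqrf_eq0 r2 gt_eqF // mulmx_tr_row_gt0.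
pose e : 'rV[R]_(1 + n) := row_mx 1%:M 0.
have we : w *m w^T = e *m e^T.
  rewrite tr_row_mx mul_row_col trmx0 mulmx0 addr0 trmx1 mulmx1.
  rewrite /w linearZ /= -scalemxAl -scalemxAr [v *m _]mx11_scalar -r2 scalerA.
  by rewrite scale_scalar_mx; congr _%:M; field.
(* [H] sends the first basis vector [e] to the unit eigenvector [w], so [e] is an eigenvector of
   [H *m A *m H]. *)
have [H [HT HH eH]] := householder _ _ _ we.
pose B : 'M[R]_(1 + n) := H *m A *m H.
have eB : e *m B = a *: e.
  rewrite /B !mulmxA eH /w -scalemxAl vA scalerA mulrC -scalerA -/w -eH.
  by rewrite -scalemxAl -mulmxA HH mulmx1.
have BT : B^T = B by rewrite /B !trmx_mul HT AT mulmxA.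
(* The first row of [B] is (a, 0); by symmetry [B] is block diagonal, and induction applies to its
   lower right block. *)
have : row_mx (ulsubmx B) (ursubmx B) = row_mx a%:M 0.
  have := eB; rewrite -[X in _ *m X](submxK B) mul_row_block !mul1mx !mul0mx.
  by rewrite !addr0 scale_row_mx scalemx1 scaler0.
move=> /eq_row_mx [Bul Bur].
have Bdl : dlsubmx B = 0 by rewrite -BT -trmx_ursub Bur trmx0.
have /IHn [Q [d [QQ Bdr]]] : (drsubmx B)^T = drsubmx B.
  by rewrite trmx_drsub BT.
pose P : 'M[R]_(1 + n) := block_mx 1%:M 0 0 Q.
pose dd : 'rV[R]_(1 + n) := row_mx a%:M d.
have BE : B = P^T *m diag_mx dd *m P.
  rewrite -[LHS]submxK Bul Bur Bdl Bdr /P /dd tr_block_mx !trmx0 trmx1.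
  rewrite diag_mx_row !mulmx_block.
  rewrite !(mulmx0, mul0mx, addr0, add0r, mulmx1, mul1mx).
  by congr block_mx; apply/matrixP => i j; rewrite !mxE !ord1 !eqxx.
have PP : P *m P^T = 1%:M.
  rewrite /P tr_block_mx !trmx0 trmx1 mulmx_block !mulmx0 !mul0mx !addr0 !add0r.
  by rewrite mulmx1 QQ -scalar_mx_block.
exists (P *m H), dd; split.
  by rewrite trmx_mul HT mulmxA -(mulmxA P) HH mulmx1.
rewrite trmx_mul HT !mulmxA -(mulmxA H) -(mulmxA H) -BE /B !mulmxA HH mul1mx.
by rewrite -mulmxA HH mulmx1.
Qed.

End RealSpectralTheorem.

(** * Kronecker products: trace and diagonal matrices *)

Section TensorProduct.
Variable R : comNzRingType.

Lemma tensmxDl m n p q (A B : 'M[R]_(m, n)) (C : 'M[R]_(p, q)) :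
  tensmx (A + B) C = tensmx A C + tensmx B C.
Proof. by apply/matrixP => i j; rewrite !mxE mulrDl. Qed.

Lemma mxtrace_tens m n (A : 'M[R]_m) (B : 'M[R]_n) :
  \tr (tensmx A B) = \tr A * \tr B.
Proof.
rewrite /mxtrace mulr_sum; apply: eq_bigr => k _.
by case: (mxtens_indexP k) => i j; rewrite tensmxE mxtens_indexK.
Qed.

(** For a 0/1 vector [e] this selects [a] in the blocks with e_i = 1 and [b] in the others. The
    affine form makes the next identity hold for every [e]. *)
Definition tens_mix_row n p (e : 'rV[R]_n) (a b : 'rV[R]_p) : 'rV[R]_(n * p) :=
  \row_k let: (i, j) := mxtens_unindex k in
    e 0 i * a 0 j + (1 - e 0 i) * b 0 j.

Lemma diag_tens_mix_row n p (e : 'rV[R]_n) (a b : 'rV[R]_p) :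
  diag_mx (tens_mix_row n p e a b) =
  tensmx (diag_mx e) (diag_mx a) + tensmx (1%:M - diag_mx e) (diag_mx b).
Proof.
apply/matrixP => k l; case: (mxtens_indexP k) => i j.
case: (mxtens_indexP l) => i' j'; rewrite [RHS]mxE !tensmxE !mxE.
rewrite mxtens_indexK (can_eq (@mxtens_indexK n p)) xpair_eqE.
by case: (i == i'); case: (j == j'); rewrite /= ?mulr1n ?mulr0n; ring.
Qed.

End TensorProduct.

(** * Spectral calculus of Kronecker products and inverses *)

Section SpectralCalculus.
Variable R : realType.

Lemma mxtrace_orthogonal_conj n (P A : 'M[R]_n) : P *m P^T = 1%:M ->
  \tr (P^T *m A *m P) = \tr A.
Proof. by move=> PP; rewrite mxtrace_mulC mulmxA PP mul1mx. Qed.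

(** The matrix acts as [A] over the range of [J] and as [B] over its orthogonal complement, so [g]
    can be applied to each summand separately. *)
Lemma mxtrace_spectral_tens_proj n p (g : R -> R) (J : 'M[R]_n)
    (A B : 'M[R]_p) :
  J^T = J -> J *m J = J -> A^T = A -> B^T = B ->
  \tr (mxspectral g (tensmx J A + tensmx (1%:M - J) B)) =
  \tr J * \tr (mxspectral g A) + \tr (1%:M - J) * \tr (mxspectral g B).
Proof.
move=> JT JJ AT BT.
have [Q [e [QQ JE]]] := symmetric_spectral R n J JT.
have [P1 [a [PP1 AE]]] := symmetric_spectral R p A AT.
have [P2 [b [PP2 BE]]] := symmetric_spectral R p B BT.
have QTQ := mulmx1C QQ.
(* [F] is made opaque so that it is handled only through the projection identities below. *)
pose E := diag_mx e; have [F FE1] : exists F, F = 1%:M - E by eexists.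
have EE : E *m E = E.
  have := congr1 (fun X => Q *m X *m Q^T) JJ; rewrite JE -/E !mulmxA QQ !mul1mx.
  by rewrite -!mulmxA QQ !mulmx1 !mulmxA -(mulmxA E Q) QQ mulmx1.
have ET : E^T = E by exact: tr_diag_mx.
have FT : F^T = F by rewrite FE1 linearB /= trmx1 ET.
have EF : E *m F = 0 by rewrite FE1 mulmxBr mulmx1 EE subrr.
have FE : F *m E = 0 by rewrite FE1 mulmxBl mul1mx EE subrr.
have FF : F *m F = F by rewrite {2}FE1 mulmxBr mulmx1 FE subr0.
have e01 i : e 0 i = 0 \/ e 0 i = 1.
  have /matrixP/(_ i i) := EE; rewrite /E mul_diag_mx !mxE eqxx mulr1n.
  move/eqP; rewrite -subr_eq0 -{3}[e 0 i]mulr1 -mulrBr mulf_eq0 subr_eq0.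
  by case/orP => /eqP ->; [left|right].
(* Row (i, j) of [W] is the tensor product of row i of [Q] with row j of [P1] if e_i = 1, of [P2] if
   e_i = 0: an orthonormal eigenbasis. *)
pose W := tensmx (E *m Q) P1 + tensmx (F *m Q) P2.
have WT : W^T = tensmx (Q^T *m E) P1^T + tensmx (Q^T *m F) P2^T.
  by rewrite /W linearD /= !trmx_tens !trmx_mul ET FT.
have QEQ X Y : (X *m Q) *m (Q^T *m Y) = X *m Y.
  by rewrite mulmxA -(mulmxA X) QQ mulmx1.
have QXQ X Y Z : (Q^T *m X *m Y) *m (Z *m Q) = Q^T *m (X *m Y *m Z) *m Q.
  by rewrite !mulmxA.
have WW : W *m W^T = 1%:M.
  rewrite WT mulmxDl !mulmxDr !tensmx_mul !QEQ EE EF FE FF !tens0mx addr0 add0r.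
  rewrite PP1 PP2 -tensmxDl FE1 addrC subrK.
  apply/matrixP => k l; case: (mxtens_indexP k) => i j.
  case: (mxtens_indexP l) => i' j'; rewrite tensmxE !mxE.
  by rewrite (can_eq (@mxtens_indexK n p)) xpair_eqE -natrM mulnb.
(* Stated for arbitrary diagonals, as it is used both before and after applying [g]. *)
have WdW a' b' : W^T *m diag_mx (tens_mix_row R n p e a' b') *m W =
    tensmx J (P1^T *m diag_mx a' *m P1) +
    tensmx (1%:M - J) (P2^T *m diag_mx b' *m P2).
  rewrite diag_tens_mix_row -/E -FE1 WT !(mulmxDl, mulmxDr) !tensmx_mul.
  rewrite !QXQ !(EE, EF, FE, FF, mul0mx, mulmx0, tens0mx, addr0, add0r).
  by rewrite FE1 mulmxBr mulmx1 mulmxBl QTQ -JE.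
(* Since each e_i is 0 or 1, every entry is a single eigenvalue of [A] or [B], so an arbitrary [g]
   passes through. *)
have mapg : map_mx g (tens_mix_row R n p e a b) =
    tens_mix_row R n p e (map_mx g a) (map_mx g b).
  apply/rowP => k; rewrite !mxE; case: (mxtens_unindex k) => i j; rewrite !mxE.
  by case: (e01 i) => ->; rewrite ?subr0 ?subrr ?mul0r ?mul1r ?addr0 ?add0r.
rewrite {1}AE {1}BE -WdW mxspectralE // mapg WdW.
rewrite [LHS]mxtraceD !mxtrace_tens.
by rewrite AE BE !mxspectralE.
Qed.

(* For negative eigenvalues a the junk value [a `^ q = 1] is compatible with
   inversion. *)
Lemma mxpowR_invmx p (A : 'M[R]_p) (q : R) : A^T = A -> A \in unitmx ->
  mxpowR (invmx A) q = mxpowR A (- q).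
Proof.
move=> AT; have [P [d [PP ->]]] := symmetric_spectral R p A AT.
have PTP := mulmx1C PP.
have [Pu PTu] := mulmx1_unit PP.
rewrite !unitmx_mul Pu PTu andbT /= unitmxE det_diag unitfE.
move=> /prodf_neq0 d0.
have -> : invmx (P^T *m diag_mx d *m P) =
    P^T *m diag_mx (map_mx (@GRing.inv R) d) *m P.
  have dd : diag_mx d *m diag_mx (map_mx (@GRing.inv R) d) = 1%:M.
    rewrite mulmx_diag -diag_const_mx; congr diag_mx.
    by apply/rowP => i; rewrite !mxE divff ?d0.
  have AB : P^T *m diag_mx d *m P *m
      (P^T *m diag_mx (map_mx (@GRing.inv R) d) *m P) = 1%:M.
    rewrite !mulmxA -(mulmxA _ P) PP mulmx1 -(mulmxA _ (diag_mx d)) dd mulmx1.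
    exact: PTP.
  by rewrite -[RHS](mulKmx (proj1 (mulmx1_unit AB))) AB mulmx1.
rewrite /mxpowR !mxspectralE //; congr (_ *m diag_mx _ *m _).
apply/rowP => i; rewrite !mxE powRN.
rewrite /powR invr_eq0 (negPf (d0 i _)) // -expRN -mulrN.
have [di|di] := ltrP 0 (d 0 i); first by rewrite lnV.
by rewrite !ln0 ?invr_le0 // oppr0.
Qed.

(** * Symmetric and positive definite matrices *)

Lemma trmx_invmx p (A : 'M[R]_p) : A^T = A -> (invmx A)^T = invmx A.
Proof. by move=> AT; rewrite trmx_inv AT. Qed.

Lemma posdefmx_unit p (A : 'M[R]_p) : posdefmx A -> A \in unitmx.
Proof.
case=> AT pos; rewrite -row_free_unit -kermx_eq0.
apply/rowV0P => v /sub_kermxP vA; apply/eqP/negP => /negP v0.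
have /pos : v^T != 0 by rewrite trmx_eq0.
by rewrite trmxK vA mul0mx mxE ltxx.
Qed.

Lemma posdefmx_inv p (A : 'M[R]_p) : posdefmx A -> posdefmx (invmx A).
Proof.
move=> Apos; have Au := posdefmx_unit _ _ Apos; have [AT pos] := Apos.
split=> [|v v0]; first exact: trmx_invmx.
have -> : v^T *m invmx A *m v = (invmx A *m v)^T *m A *m (invmx A *m v).
  by rewrite trmx_mul trmx_invmx // mulmxKV // mulmxA.
apply: pos; apply: contra v0 => /eqP/(congr1 (mulmx A)).
by rewrite mulKVmx // mulmx0 => ->.
Qed.

Lemma posdefmxZ p (c : R) (A : 'M[R]_p) : 0 < c -> posdefmx A ->
  posdefmx (c *: A).
Proof.
move=> c0 [AT pos]; split=> [|v v0]; first by rewrite linearZ /= AT.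
by rewrite -scalemxAr -scalemxAl mxE mulr_gt0 // pos.
Qed.

(** Serves to make M + Delta^-1 invertible: M is a semidefinite sum of rank-one terms, and Delta^-1
    is definite. *)
Lemma posdefmxD_semidef p (A B : 'M[R]_p) : A^T = A ->
  (forall v : 'cV[R]_p, 0 <= (v^T *m A *m v) 0 0) -> posdefmx B ->
  posdefmx (A + B).
Proof.
move=> AT pos [BT Bpos]; split=> [|v v0]; first by rewrite linearD /= AT BT.
by rewrite mulmxDr mulmxDl mxE ltr_wpDl // Bpos.
Qed.

End SpectralCalculus.

(** * Symmetry and semidefiniteness of the information matrix *)

Section InformationMatrix.
Variables (R : realType) (X : Type) (p : nat) (f : X -> 'cV[R]_p).

Lemma trmx_information (xi : design R X) :
  (information_mx f xi)^T = information_mx f xi.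
Proof.
rewrite /information_mx linear_sum; apply: eq_bigr => j _ /=.
by rewrite linearZ /= trmx_mul trmxK.
Qed.

Lemma information_mx_semidef (xi : design R X) (v : 'cV[R]_p) :
  0 <= (v^T *m information_mx f xi *m v) 0 0.
Proof.
rewrite /information_mx mulmx_sumr mulmx_suml summxE sumr_ge0 // => j _.
rewrite -scalemxAr -scalemxAl mxE mulr_ge0 ?design_weight_ge0 // mulmxA.
(* [y] is the scalar v^T f(x_j), and the summand is its square times the weight. *)
set y := v^T *m _; rewrite -mulmxA -[_ *m v]trmxK trmx_mul trmxK -/y.
by rewrite mxE big_ord1 [X in _ * X]mxE -expr2 sqr_ge0.
Qed.

End InformationMatrix.


Theorem theorem1 (R : realType) (X : Type) (p m n : nat)
    (hp : (0 < p)%N) (hm : (0 < m)%N) (hn : (0 < n)%N)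
    (f : X -> 'cV[R]_p) (D : 'M[R]_p) (hD : posdefmx D)
    (q : R) (hq : 0 < q)
    (xi : design R X) (hM : information_mx f xi \in unitmx) :
  Kiefer_Phi f m n D q xi =
  ((n * p)%:R^-1 *
     (\tr (mxpowR (information_mx f xi) (- q))
      + (n%:R - 1) *
        \tr (mxpowR (information_mx f xi + invmx (Delta_mx m D)) (- q))))
  `^ q^-1.
Proof.
have MT := trmx_information _ _ _ f xi.
have Npos : posdefmx (information_mx f xi + invmx (Delta_mx m D)).
  apply: posdefmxD_semidef => //; first exact: information_mx_semidef.
  by apply/posdefmx_inv/posdefmxZ => //; rewrite ltr0n.
have [NT _] := Npos; have Nu := posdefmx_unit _ _ _ Npos.
have n0 : n%:R != 0 :> R by rewrite pnatr_eq0 -lt0n.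
rewrite /Kiefer_Phi /MSE_mx /=; set u := const_mx 1; set J := _ *: (u *m u^T).
(* Both the trace of [J] and its idempotence reduce to this squared length of the all-ones
   vector. *)
have uu : u^T *m u = n%:R%:M.
  rewrite [LHS]mx11_scalar mxE; congr _%:M.
  under eq_bigr do rewrite !mxE mulr1.
  by rewrite sumr_const card_ord.
have trJ : \tr J = 1 by rewrite mxtraceZ mxtrace_mulC uu mxtrace_scalar mulVf.
have JT : J^T = J by rewrite linearZ /= trmx_mul trmxK.
have JJ : J *m J = J.
  rewrite -scalemxAl -scalemxAr mulmxA -(mulmxA u) uu mul_mx_scalar.
  by rewrite -scalemxAl !scalerA; congr (_ *: _); field.
(* The negative powers on the right become q-th powers of inverses, the form in which the projection
   formula yields the left side. *)
rewrite -!mxpowR_invmx // /mxpowR mxtrace_spectral_tens_proj ?trmx_invmx //.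
by rewrite linearB /= trJ mxtrace1 mul1r.
Qed.
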